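(* Let $M$ be a rooted map whose underlying directed graph is $G$ (so $G$ is connected). Then $$N(G)=\sum_{T\text{ good spanning tree of }M}\ \prod_{e\in E_G\setminus E_T}\big(x_{\alpha(e)}-x_{\omega(e)}\big).$$ In particular the right-hand side does not depend on the choice of rooted map structure on $G$.
   Context: A directed graph $G$ has finite vertex set $V_G$ and edges $E_G$, each edge $e$ having origin $\alpha(e)$ and end $\omega(e)$. A linear extension of $G$ is a total order on $V_G$ with $\alpha(e)$ before $\omega(e)$ for every edge, written as the word $w=w_1\cdots w_n$ in increasing order; $\mathcal L(G)$ is their set. $\Psi(G)=\sum_{w\in\mathcal L(G)}\prod_{i=1}^{n-1}(x_{w_i}-x_{w_{i+1}})^{-1}$ and $N(G)=\Psi(G)\prod_{e\in E_G}(x_{\alpha(e)}-x_{\omega(e)})$. A rooted map on a connected graph $G$: each edge $e$ is split into two half-edges (darts), its first dart attached to $\alpha(e)$ and its second dart attached to $\omega(e)$; a permutation $\sigma$ of the darts is given whose orbits are exactly the sets of darts attached to a common vertex (so $\sigma$ gives a cyclic order of the darts around each vertex); in addition there is an external dart $h_0$, belonging to no edge, attached to a vertex $\star$ and inserted at some place in the cyclic order around $\star$. A spanning tree $T$ of $G$ (edges orientation ignored) has edge set $E_T\subset E_G$. The tour of $T$ starting at $h_0$ is the contour walk around $T$: from the current dart $h$ at vertex $u$, pass to the next dart $\sigma(h)$ around $u$; if it is a dart of an edge of $T$, cross that edge to its other dart at the other endpoint and continue from there; if it is a dart of an edge not in $T$, record it and continue from it at $u$; stop on returning to $h_0$. This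 visits every dart of every edge not in $T$ exactly once and thus orders these darts. $T$ is called good if, for every edge $e\in E_G\setminus E_T$, the first dart of $e$ (the one at $\alpha(e)$) appears before its second dart (the one at $\omega(e)$) in the tour of $T$. *)

(* Defs.v *)
From mathcomp Require Import all_boot all_order all_algebra fingroup perm.
From mathcomp Require Import fraction mpoly.

Set Implicit Arguments.
Unset Strict Implicit.
Unset Printing Implicit Defensive.

Import GRing.Theory.
Local Open Scope ring_scope.

(* Loops, parallel edges and directed circuits are allowed. *)
Record digraph := Digraph {
  vertex : finType;
  edge : finType;
  origin : edge -> vertex;   (* alpha *)
  target : edge -> vertex    (* omega *)
}.

Section Graph.
Variable G : digraph.
Implicit Types (T : {set edge G}).

(* [(e, false)] is the first dart of [e], at its origin; [(e, true)] is the
   second one, at its end. *)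
Definition dart : finType := (edge G * bool)%type.

Definition dart_vertex (d : dart) : vertex G :=
  if d.2 then target d.1 else origin d.1.

Definition opp_dart (d : dart) : dart := (d.1, ~~ d.2).

Definition adjacent T : rel (vertex G) := fun u v =>
  [exists d : dart,
    [&& d.1 \in T, dart_vertex d == u & dart_vertex (opp_dart d) == v]].

Definition connected_by T : bool :=
  [forall u, forall v, connect (adjacent T) u v].

Definition connected : bool := connected_by [set: edge G].

(* A dart stands for its edge traversed away from the vertex of the dart; a
   cycle repeats neither edges nor vertices.  A loop is a cycle of length 1
   and two parallel edges form a cycle of length 2. *)
Definition is_cycle T (c : seq dart) : bool :=
  [&& c != [::], all (fun d => d.1 \in T) c,
      path.cycle (fun d d' => dart_vertex (opp_dart d) == dart_vertex d') c,
      uniq (map fst c) & uniq (map dart_vertex c)].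

(* Distinct edges bound the length of a cycle by [#|edge G|]; see [acyclicP]. *)
Definition acyclic T : bool :=
  [forall k : 'I_#|edge G|.+1, forall c : k.-tuple dart, ~~ is_cycle T c].

Lemma acyclicP T :
  reflect (forall c : seq dart, ~~ is_cycle T c) (acyclic T).
Proof.
apply: (iffP forallP) => [acT c | acT k]; last by apply/forallP.
apply/negP => cyc; have [_ _ _ Uc _] := and5P cyc.
have lt_c : (size c < #|edge G|.+1)%N.
  by rewrite ltnS -(size_map fst) -(card_uniqP Uc) max_card.
by have /forallP/(_ (in_tuple c)) := acT (Ordinal lt_c); rewrite /= cyc.
Qed.

Definition spanning_tree T : bool := connected_by T && acyclic T.

(* A total order on the vertices, as the word listing them increasingly. *)
Definition linear_extension (w : #|vertex G|.-tuple (vertex G)) : bool :=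
  uniq w && [forall e : edge G, (index (origin e) w < index (target e) w)%N].

Definition ratfun : fieldType := {fraction {mpoly rat[#|vertex G|]}}.

Definition xvar (v : vertex G) : ratfun := tofrac 'X_(enum_rank v).

(* [zip w (behead w)] lists the pairs of consecutive letters of [w]. *)
Definition Psi : ratfun :=
  \sum_(w : #|vertex G|.-tuple (vertex G) | linear_extension w)
    \prod_(p <- zip w (behead w)) (xvar p.1 - xvar p.2)^-1.

Definition Nnum : ratfun :=
  Psi * \prod_(e : edge G) (xvar (origin e) - xvar (target e)).

(* [None] is the external dart. *)
Definition xdart : finType := option dart.

Definition xdart_vertex (root : vertex G) (h : xdart) : vertex G :=
  if h is Some d then dart_vertex d else root.

(* [rotation] acts on all darts, the external one included: it encodes both
   the cyclic orders and the place where the external dart is inserted. *)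
Record rooted_map := RootedMap {
  root : vertex G;
  rotation : {perm xdart};
  rotation_orbits : forall h : xdart,
    porbit rotation h = [set h' | xdart_vertex root h' == xdart_vertex root h]
}.

Section Tour.
Variables (M : rooted_map) (T : {set edge G}).

Definition cross (h : xdart) : xdart :=
  if h is Some d then (if d.1 \in T then Some (opp_dart d) else h) else None.

Definition tour_step (h : xdart) : xdart := cross (rotation M h).

Lemma tour_step_inj : injective tour_step.
Proof.
have crossK : involutive cross.
  by move=> [[e b]|] //=; case eT: (e \in T); rewrite /= eT // /opp_dart /= negbK.
exact: inj_comp (inv_inj crossK) (@perm_inj _ _).
Qed.

(* As [tour_step] is injective, [orbit tour_step None] is the walk from the
   external dart until the first return to it. *)
Definition tour : seq dart :=
  [seq d <- pmap id (orbit tour_step None) | d.1 \notin T].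

Definition good : bool :=
  [forall e : edge G,
    (e \notin T) ==> (index (e, false) tour < index (e, true) tour)%N].

End Tour.

Definition good_tree_sum (M : rooted_map) : ratfun :=
  \sum_(T : {set edge G} | spanning_tree T && good M T)
    \prod_(e : edge G | e \notin T) (xvar (origin e) - xvar (target e)).

End Graph.

(* Main.v *)
(* Fix the root r.  Inserting a leaf into a word at every place after its
   parent telescopes, so a tree rooted at r and oriented away from it has
   product prod_e 1/(x_parent - x_child) equal to the sum, over its increasing
   words, of prod_i 1/(x_{w_i} - x_{w_{i+1}}).  Applied to spanning trees, and
   to words w viewed as paths hanging from r, this expands both sides over the
   words starting with r, and it suffices to compare the coefficients of one
   such word.

   On both sides the coefficient is a product over the letters z <> r of
   [all edges between z and earlier letters enter z] - [they all leave z].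
   For linear extensions, each z goes to the right end or, with sign -1, to the
   left end of the word already built.  For trees, attaching z through a dart d
   inserts the darts of z in the tour just before d; hence, ordering the edges
   from z to earlier letters along the tour, goodness asks that those before
   the tree edge enter z and those after it leave z.  Such sign patterns have
   the same signed count, whatever the earlier choices. *)
Require Import Defs.
From mathcomp Require Import all_boot all_order all_algebra fingroup perm.
From mathcomp Require Import fraction mpoly ring zify.

Set Implicit Arguments.
Unset Strict Implicit.
Unset Printing Implicit Defensive.

Import GRing.Theory.
Local Open Scope ring_scope.

(** * Growing rooted trees and their increasing words *)

Lemma uniq_flatten_map (A B : eqType) (f : A -> seq B) (g : B -> A) (s : seq A) :
  uniq s -> {in s, forall a, uniq (f a)} ->
  {in s, forall a, {in f a, forall b, g b = a}} -> uniq (flatten (map f s)).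
Proof.
elim: s => //= a s IHs /andP[a_s Us] Uf fK.
rewrite cat_uniq Uf ?mem_head //= IHs //; last 2 first.
- by move=> b bs; apply: Uf; rewrite inE bs orbT.
- by move=> b bs; apply: fK; rewrite inE bs orbT.
rewrite andbT; apply/hasPn => b /flatten_mapP[a' a's fb].
apply: contra a_s => fb'.
by rewrite -(fK a _ b fb') ?mem_head // (fK a' _ b fb) // inE a's orbT.
Qed.

Section Growth.
Variables (F : fieldType) (V D : eqType) (x : V -> F) (c p : D -> V) (r : V).
Hypothesis x_inj : injective x.
Implicit Types (d : D) (t u : seq D).

(* A growth adds, at each step, a new vertex [c d] below an already reached
   vertex [p d]; the most recent step comes first and the root [r] is last. *)
Fixpoint verts t := if t is d :: t' then c d :: verts t' else [:: r].

Fixpoint grows t :=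
  if t is d :: t' then [&& c d \notin verts t', p d \in verts t' & grows t']
  else true.

(** Words are stored with the latest letter first, so this is the product of inverse consecutive
    differences of the reversed word. *)
Fixpoint chain (w : seq V) : F :=
  if w is a :: w' then
    (if w' is b :: _ then (x b - x a)^-1 else 1) * chain w'
  else 1.

(* The insertions of [d] into [t] that keep it more recent than [p d]. *)
Fixpoint ins d t : seq (seq D) :=
  (d :: t) ::
  (if t is y :: t' then if p d == c y then [::] else map (cons y) (ins d t')
   else [::]).

Fixpoint exts t : seq (seq D) :=
  if t is d :: t' then flatten (map (ins d) (exts t')) else [:: [::]].

Lemma vertsE t : verts t = rcons (map c t) r.
Proof. by elim: t => //= d t ->. Qed.

Lemma mem_verts t v : (v \in verts t) = (v == r) || (v \in map c t).
Proof. by rewrite vertsE mem_rcons. Qed.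

Lemma perm_verts t u : perm_eq t u -> verts t =i verts u.
Proof. by move=> tu v; rewrite !mem_verts (perm_mem (perm_map c tu)). Qed.

Lemma grows_uniq t : grows t -> uniq (verts t).
Proof. by elim: t => //= d t IHt /and3P[-> _ /IHt]. Qed.

Lemma grows_parent t d : grows t -> d \in t -> p d \in verts t.
Proof.
elim: t => //= y t IHt /and3P[_ py gt]; rewrite !inE.
by case/orP=> [/eqP-> | /(IHt gt)->]; rewrite ?py orbT.
Qed.

(** Relative to [chain (verts t)], putting [c d] in front of the first letter [y] contributes
    [-1/(x_d - x_y)], and putting it between [y] and the next older letter [z] contributes
    [1/(x_d - x_y) - 1/(x_d - x_z)]. The sum telescopes down to the parent [p d]. *)
Lemma sum_ins d t :
  c d \notin verts t -> uniq (verts t) -> p d \in verts t ->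
  \sum_(u <- ins d t) chain (verts u) =
    (x (p d) - x (c d))^-1 * chain (verts t).
Proof.
elim: t => [|y t IHt] /=.
  by rewrite big_seq1 /= !inE => _ _ /eqP->.
rewrite !inE negb_or => /andP[dy dt] /andP[yt Ut] pd.
rewrite big_cons; case: eqP pd => [pdy _|_ /= pd].
  by rewrite big_nil /= addr0 pdy.
rewrite big_map.
have zP : exists z w, verts t = z :: w.
  by case: (t) => [|y2 t2]; [exists r, [::] | exists (c y2), (verts t2)].
have [z [w def_t]] := zP.
(* In the insertions [R] the head [z] is unchanged, so putting [c y] on top costs a constant factor.
   The insertion in front of [z] is treated apart, which leaves an identity between four values of
   [x]. *)
have [R def_R RP] : exists2 R, ins d t = (d :: t) :: R &
    {in R, forall u, chain (c y :: verts u) = (x z - x (c y))^-1 * chain (verts u)}.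
  case: (t) def_t => [|y2 t2] /= def_t; first by exists [::].
  case: eqP => _; first by exists [::].
  exists (map (cons y2) (ins d t2)) => // u /mapP[u' _ ->] /=.
  by case: def_t => ->.
have := IHt dt Ut pd; rewrite {}def_R !big_cons => /(canRL (addKr _)) sumR.
rewrite (eq_big_seq _ RP) -big_distrr {}sumR /= def_t /=.
have pcd : p d != c d by apply: contraNneq dt => <-.
move: dt yt; rewrite def_t !inE !negb_or => /andP[dz _] /andP[yz _].
move: pcd dy dz yz; rewrite -!(inj_eq x_inj).
move: (match w with [::] => _ | _ => _ end) (chain w) => B C.
move: (x (p d)) (x (c d)) (x (c y)) (x z) => a b e f ab be bf ef.
by field; rewrite !subr_eq0 ab be ![f == _]eq_sym bf ef eq_sym be.
Qed.

(** Deleting [d] undoes the insertion; this is what makes insertions into distinct growths distinct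
    in [uniq_exts]. *)
Lemma mem_ins d t u :
  grows t -> c d \notin verts t -> p d \in verts t ->
  (u \in ins d t) = [&& d \in u, rem d u == t & grows u].
Proof.
move=> gt dt pd; have pcd : p d != c d by apply: contraNneq dt => <-.
apply/idP/and3P => [|[]].
  elim: t u gt dt pd => [|y t IHt] u /=.
    rewrite !inE => _ dr pd /eqP->; rewrite mem_head /= eqxx; split=> //=.
    by rewrite !inE dr pd.
  case/and3P=> yt py gt dt pd; rewrite inE => /orP[/eqP->|].
    rewrite mem_head /= eqxx; split=> //=; apply/and5P; split=> //.
  move: dt pd; rewrite !inE negb_or => /andP[dy dt].
  case: eqP => //= _ pd /mapP[u' /(IHt u' gt dt pd)[du' /eqP ru' gu'] ->] /=.
  rewrite inE du' orbT; split=> //.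
    by rewrite ru'; case: (y =P d) dy => [->|]; rewrite eqxx.
  have /perm_verts Du' := perm_to_rem du'.
  by rewrite gu' !Du' ru' /= !inE negb_or yt py orbT !andbT eq_sym.
elim: u t gt dt pd => //= a u IHu t gt dt pd.
rewrite inE eq_sym; case: eqP => [->|ad] /=.
  by move=> _ /eqP->; case: (t) => *; apply: mem_head.
move=> du /eqP def_t /and3P[au pa gu]; rewrite -{t}def_t in gt dt pd *.
have [at' pa' gt'] := and3P gt.
have pdu : p d \in verts u by apply: grows_parent.
rewrite !inE (negPf (_ : p d != c a)); last by apply: contraNneq au => <-.
rewrite map_f ?orbT // IHu //; first by move: dt; rewrite inE negb_or => /andP[].
by have := pd; rewrite inE (negPf (_ : p d != c a)) //; apply: contraNneq au => <-.
Qed.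

Lemma uniq_ins d t : c d \notin verts t -> uniq (ins d t).
Proof.
elim: t => //= y t IHt; rewrite inE negb_or => /andP[dy /IHt Ut].
case: eqP => //= _; rewrite map_inj_uniq ?Ut ?andbT; last by move=> ? ? [].
by apply/mapP => -[u _ [yd _]]; rewrite yd eqxx in dy.
Qed.

Lemma grows_rem d t :
  {in t, forall y, p y != c d} -> grows t -> d \in t -> grows (rem d t).
Proof.
elim: t => //= a t IHt leaf /and3P[at' pa gt]; rewrite inE eq_sym.
case: eqP => [//|ad] /= dt.
have leaf' : {in t, forall y, p y != c d} by move=> y yt; apply: leaf; rewrite inE yt orbT.
have /perm_verts Dt := perm_to_rem dt.
rewrite IHt // andbT; move: at' pa; rewrite !Dt /= !inE negb_or.
by rewrite (negPf (leaf a _)) ?mem_head //= => /andP[_ ->] ->.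
Qed.

(** The latest vertex of [t] is the parent of no dart of [t], so it can be deleted from any growth
    with the same darts, and [ins] puts it back. *)
Lemma mem_exts t u : grows t -> (u \in exts t) = perm_eq u t && grows u.
Proof.
elim: t u => [|d t IHt] u /=.
  by move=> _; rewrite inE; case: u => [|a u] //=; apply/esym/negP => /andP[/perm_size].
case/and3P=> dt pd gt; apply/flatten_mapP/andP=> [[t']|[ud gu]].
  rewrite IHt // => /andP[t't gt']; have Dt := perm_verts t't.
  rewrite mem_ins ?Dt // => /and3P[du /eqP ru gu]; split=> //.
  by rewrite (permPl (perm_to_rem du)) perm_cons ru.
have du : d \in u by rewrite (perm_mem ud) mem_head.
have rt : perm_eq (rem d u) t.
  by rewrite -(perm_cons d) -(permPl (perm_to_rem du)).
have gr : grows (rem d u).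
  apply: grows_rem => // y; rewrite (perm_mem ud) => yt.
  apply: contraNneq dt => <-; move: yt; rewrite inE => /orP[/eqP->//|].
  exact: grows_parent.
exists (rem d u); first by rewrite IHt // rt.
by rewrite mem_ins ?(perm_verts rt) // du eqxx.
Qed.

Lemma uniq_exts t : grows t -> uniq (exts t).
Proof.
elim: t => //= d t IHt /and3P[dt pd gt].
have inP t' : t' \in exts t -> [/\ grows t', c d \notin verts t' & p d \in verts t'].
  by rewrite mem_exts // => /andP[/perm_verts Dt gt']; rewrite gt' !Dt.
apply: (@uniq_flatten_map _ _ _ (rem d)); first exact: IHt.
- by move=> t' /inP[_ dt' _]; apply: uniq_ins.
by move=> t' /inP[gt' dt' pd'] u; rewrite mem_ins // => /and3P[_ /eqP].
Qed.

Lemma sum_exts t : grows t ->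
  \sum_(u <- exts t) chain (verts u) = \prod_(d <- t) (x (p d) - x (c d))^-1.
Proof.
elim: t => [|d t IHt] /=; first by rewrite big_seq1 big_nil /= mulr1.
case/and3P=> dt pd gt; rewrite big_flatten big_map big_cons -IHt // big_distrr.
apply: eq_big_seq => t'; rewrite mem_exts // => /andP[/perm_verts Dt gt'].
by rewrite sum_ins ?grows_uniq ?Dt.
Qed.

End Growth.

(** * Spanning trees *)

Lemma map_uniq_inj (A B : eqType) (f : A -> B) (s : seq A) :
  uniq (map f s) -> {in s &, injective f}.
Proof.
elim: s => //= a s IHs /andP[fa Us] b b' /predU1P[->|bs] /predU1P[->|b's] //.
- by move=> fb; rewrite fb map_f in fa.
- by move=> fb; rewrite -fb map_f in fa.
exact: IHs.
Qed.

Section TreeGrowth.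
Variables (G : digraph) (r : vertex G).
Implicit Types (d : dart G) (t : seq (dart G)) (T : {set edge G}).

Notation top := (@dart_vertex G).
Notation bot := (fun d => dart_vertex (opp_dart d)).
Notation reached := (verts top r).
Notation growth := (grows top bot r).

Definition tree_of t : {set edge G} := [set e in map fst t].

Lemma opp_dartK : involutive (@opp_dart G).
Proof. by case=> e b; rewrite /opp_dart /= negbK. Qed.

Lemma dart_eq_edge d d' : d.1 = d'.1 -> d = d' \/ d = opp_dart d'.
Proof.
by case: d d' => e b [e' b'] /= ->; case: b b' => [] []; rewrite /opp_dart; auto.
Qed.

Lemma opp_dart_neq d : opp_dart d != d.
Proof. by case: d => e [] /=; rewrite /opp_dart xpair_eqE andbF. Qed.

Lemma mem_tree_of t d : (d.1 \in tree_of t) = (d \in t) || (opp_dart d \in t).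
Proof.
rewrite inE; apply/mapP/orP => [[d' d't] /dart_eq_edge[->|->] | [] dt].
- by left.
- by right; rewrite opp_dartK.
- by exists d.
by exists (opp_dart d).
Qed.

Lemma tree_of_cons d t : tree_of (d :: t) = d.1 |: tree_of t.
Proof. by apply/setP=> e; rewrite !inE. Qed.

Lemma tree_of_perm t t' : perm_eq t t' -> tree_of t = tree_of t'.
Proof. by move=> tt'; apply/setP=> e; rewrite !inE (perm_mem (perm_map _ tt')). Qed.

Lemma growth_ends t d : growth t -> d.1 \in tree_of t -> top d \in reached t.
Proof.
move=> gt; rewrite mem_tree_of => /orP[dt | /(grows_parent gt)].
  by rewrite mem_verts map_f ?orbT.
by rewrite opp_dartK.
Qed.

Lemma growth_new_edge d t : growth t -> top d \notin reached t -> d.1 \notin tree_of t.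
Proof. by move=> gt; apply: contra; apply: growth_ends. Qed.

Lemma adjacent_sym T u v : adjacent T u v = @adjacent G T v u.
Proof.
apply/existsP/existsP => -[d /and3P[dT du dv]];
  by exists (opp_dart d); rewrite dT opp_dartK dv du.
Qed.

Lemma growth_connect t T v :
  growth t -> tree_of t \subset T -> v \in reached t -> connect (adjacent T) r v.
Proof.
elim: t v => [|d t IHt] v /=; first by rewrite inE => _ _ /eqP->.
case/and3P=> dt pd gt; rewrite tree_of_cons subUset sub1set => /andP[dT tT].
rewrite inE => /orP[/eqP->|]; last exact: IHt.
apply: connect_trans (IHt _ gt tT pd) (connect1 _).
by apply/existsP; exists (opp_dart d); rewrite dT opp_dartK !eqxx.
Qed.

Lemma growth_connected t :
  growth t -> (forall v, v \in reached t) -> connected_by (tree_of t).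
Proof.
move=> gt full; apply/forallP=> u; apply/forallP=> v.
apply: (@connect_trans _ _ r); last exact: growth_connect gt _ _.
by rewrite (sym_connect_sym (@adjacent_sym _)); apply: growth_connect gt _ _.
Qed.

(* A newly reached vertex is a leaf, so no cycle goes through it. *)
Lemma growth_acyclic t : growth t -> acyclic (tree_of t).
Proof.
move=> gt; apply/acyclicP; elim: t gt => [|d t IHt] /=.
  move=> _ [|a s] //; apply/negP=> /and5P[_ /=]; by rewrite inE.
case/and3P=> dt pd gt s; apply/negP=> /and5P[s0 sT cs Us Uv].
have leaf y : y.1 \in tree_of (d :: t) -> top y = top d -> y = d.
  move=> yT yd; move: yT; rewrite tree_of_cons !inE => /orP[/eqP/dart_eq_edge[]//|].
    by move=> def_y; move: dt; rewrite -yd def_y pd.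
  by move=> yT; move: dt; rewrite -yd growth_ends // inE.
(* The dart before [d] in the cycle would end at the leaf, hence be [opp_dart d], and the cycle
   would use one edge twice. *)
have no_d : d \notin s.
  apply/negP=> ds; have := prev_cycle cs ds; set z := prev s d => /eqP zd.
  have zs : z \in s by rewrite mem_prev.
  have oz : opp_dart z = d by exact: (leaf (opp_dart z) (allP sT _ zs) zd).
  have zd1 : z.1 = d.1 by rewrite -oz.
  have : z = d by apply: (map_uniq_inj Us).
  by move=> zd2; have := opp_dart_neq d; rewrite -{1}zd2 oz eqxx.
have /negP[] := IHt gt s; apply/and5P; split=> //; apply/allP=> y ys.
have := allP sT _ ys; rewrite tree_of_cons !inE => /orP[/eqP/dart_eq_edge[]|//] def_y.
  by rewrite -def_y ys in no_d.
(* After [opp_dart d] the cycle would have to leave the leaf, that is, through [d]. *)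
have := next_cycle cs ys; rewrite {1}def_y opp_dartK => /eqP def_n.
have ns : next s y \in s by rewrite mem_next.
have nd : next s y = d by apply: (leaf _ (allP sT _ ns)).
by rewrite -nd ns in no_d.
Qed.

Lemma growth_spanning_tree t :
  growth t -> (forall v, v \in reached t) -> spanning_tree (tree_of t).
Proof. by move=> gt full; rewrite /spanning_tree growth_connected ?growth_acyclic. Qed.

(** Both growths orient the tree edges away from [r]. Going through [t] from the oldest dart,
    suppose [opp_dart d] is in [t']. Its vertex is not [r], so it is the vertex of an older dart of
    [t], already known to be in [t'] and hence equal to [opp_dart d]; then the vertex of [d] was
    reached before [d]. *)
Lemma growth_same_tree t t' :
  growth t -> growth t' -> tree_of t = tree_of t' -> size t = size t' ->
  perm_eq t t'.
Proof.
move=> gt gt' eqT eqs.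
have Ut u : growth u -> uniq (map top u) /\ r \notin map top u.
  by move/grows_uniq; rewrite vertsE rcons_uniq => /andP[].
have [[U _] [U' r']] := (Ut _ gt, Ut _ gt').
have sub : {subset t <= t'}.
  have : {subset tree_of t <= tree_of t'} by rewrite eqT.
  elim: (t) gt => //= d u IHu /and3P[du pd gu] sub.
  have subu : {subset u <= t'}.
    by apply: IHu => // e eu; apply: sub; rewrite tree_of_cons !inE in eu *;
      rewrite eu orbT.
  move=> y; rewrite inE => /orP[/eqP-> {y}|]; last exact: subu.
  have : d.1 \in tree_of t' by apply: sub; rewrite tree_of_cons !inE eqxx.
  rewrite mem_tree_of => /orP[//|odt].
  move: pd; rewrite mem_verts => /orP[/eqP rd | /mapP[d2 d2u def_d2]].
    by rewrite -rd map_f in r'.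
  have d2d : d2 = opp_dart d.
    by apply: (map_uniq_inj U') => //; apply: subu.
  have := grows_parent gu d2u; rewrite d2d opp_dartK => du'.
  by rewrite du' in du.
apply: uniq_perm; [exact: map_uniq U | exact: map_uniq U' |].
by apply: (uniq_min_size (map_uniq U) sub _).2; rewrite eqs.
Qed.

(** Lifts a path without repeated vertices to darts. The edges are distinct because the later ones
    have both ends in the tail, which avoids the first vertex. *)
Lemma dart_path T a (s : seq (vertex G)) d0 :
  path (adjacent T) a s -> uniq (a :: s) -> top (opp_dart d0) = a ->
  exists q : seq (dart G), [/\ all (fun d => d.1 \in T) q,
    path (fun d d' => top (opp_dart d) == top d') d0 q,
    map top q = belast a s, last a (map bot q) = last a s &
    {in q, forall d, (top d \in a :: s) && (bot d \in a :: s)} /\ uniq (map fst q)].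
Proof.
elim: s a d0 => [|v s IHs] a d0 /=; first by exists [::]; split.
case/andP=> /existsP[d /and3P[dT /eqP da /eqP dv]] ps /andP[a_s Us] d0a.
have [q [qT pq tq lq [iq Uq]]] := IHs v d ps Us dv.
exists (d :: q); split=> /=.
- by rewrite dT.
- by rewrite d0a da eqxx.
- by rewrite tq da.
- by rewrite dv.
split.
  move=> y; rewrite inE => /orP[/eqP-> | /iq /andP[ty oy]].
    by rewrite da dv !inE !eqxx orbT.
  by rewrite in_cons ty in_cons oy !orbT.
rewrite Uq andbT; apply: contra a_s => /mapP[y yq /dart_eq_edge dy].
have /andP[ty oy] := iq y yq.
by case: dy => def_y; rewrite -da def_y.
Qed.

(** An edge of [T] outside [T'] would close a cycle with a path of [T'] joining its ends. *)
Lemma connected_acyclic_max T T' :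
  connected_by T' -> T' \subset T -> acyclic T -> T' = T.
Proof.
move=> conn sub /acyclicP acyc; apply/eqP; rewrite eqEsubset sub /=.
apply/subsetP=> e eT; apply: contraT => eT'.
have loopless : origin e != target e.
  apply/negP=> /eqP oe; have /negP[] := acyc [:: (e, false)].
  by rewrite /is_cycle /= eT /dart_vertex /= oe eqxx.
have /connectP[s0 ps0 def_o] := forallP (forallP conn (target e)) (origin e).
case/shortenP: ps0 def_o => s ps Us _ def_o.
have [q [qT' pq tq lq [_ Uq]]] := dart_path (d0 := (e, false)) ps Us (erefl _).
have /negP[] := acyc ((e, false) :: q); apply/and5P; split=> //=.
- by rewrite eT; apply/allP=> d /(allP qT')/(subsetP sub).
- rewrite rcons_path pq /=; move: lq; rewrite -def_o.
  case/lastP: {pq tq qT' Uq} q => [|q d].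
    by move=> /= oe; rewrite oe eqxx in loopless.
  by rewrite map_rcons !last_rcons => ->; rewrite eqxx.
- by rewrite Uq andbT; apply: contra eT' => /mapP[d /(allP qT') dT' ->].
rewrite {1}/dart_vertex /= def_o tq -rcons_uniq -lastI; exact: Us.
Qed.

Lemma growth_exists T : spanning_tree T ->
  exists2 t, growth t & (forall v, v \in reached t) /\ tree_of t = T.
Proof.
case/andP=> conn acyc.
suff [t [gt sub full]] : exists t, [/\ growth t, tree_of t \subset T &
    forall v, v \in reached t].
  exists t => //; split=> //.
  by apply: connected_acyclic_max => //; apply: growth_connected.
(* Darts are added one at a time while a vertex is missing. Size [#|vertex G|] is impossible, since
   [reached t] has one more letter than [t]. *)
have [t [gt sub [//|szt]]] : exists t, [/\ growth t, tree_of t \subset T &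
    (forall v, v \in reached t) \/ (#|vertex G| <= size t)%N]; last 2 first.
- by exists t.
- have := max_card (mem (reached t)).
  by rewrite (card_uniqP (grows_uniq gt)) vertsE size_rcons size_map ltnNge szt.
elim: #|vertex G| => [|n [t [gt sub [full|szt]]]]; last 2 first.
- by exists t; split=> //; left.
- have [v vt|full] := pickP [pred v | v \notin reached t]; last first.
    by exists t; split=> //; left=> v; have /= /negbFE := full v.
  (* A path from [r] to the missing vertex [v] has an edge leaving the reached set; its dart extends
     the growth. *)
  have /connectP[s ps def_v] := forallP (forallP conn r) v.
  have rt : r \in reached t by rewrite mem_verts eqxx.
  rewrite /= {v}def_v in vt; move: rt ps vt; move: {1 3 4}r => a.
  elim: s a => [|b s IHs] a /= at' => [_|]; first by rewrite at'.
  case/andP=> /existsP[d /and3P[dT /eqP da /eqP db]] ps.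
  case bt: (b \in reached t); first exact: IHs.
  move=> _; exists (opp_dart d :: t); rewrite tree_of_cons subUset sub1set dT sub.
  by split=> //=; [rewrite db bt opp_dartK da at' | right].
by exists [::]; split=> //; [apply/subsetP=> e; rewrite inE | right].
Qed.

End TreeGrowth.

(** * The tour of a growing tree *)

Definition insert_before (A : eqType) (b : A) (m s : seq A) :=
  take (index b s) s ++ m ++ drop (index b s) s.

Lemma orbit_fcycle (A : finType) (f : A -> A) a s :
  fcycle f (a :: s) -> uniq (a :: s) -> orbit f a = a :: s.
Proof.
move=> fs Us; rewrite /orbit (order_cycle fs Us) ?mem_head //=.
move: fs; rewrite /= rcons_path => /andP[/fpathP[n ->] _].
by rewrite size_traject.
Qed.

Lemma fpath_eq (A : eqType) (f g : A -> A) a s :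
  (forall y, f y \in s -> g y = f y) -> fpath f a s -> fpath g a s.
Proof.
elim: s a => //= b s IHs a fg /andP[/eqP fa fs].
rewrite fg ?fa ?mem_head // eqxx IHs // => y ys.
by rewrite fg // inE ys orbT.
Qed.

(** Here [g] is [f] followed by the transposition of [b] and [c], which lie on different cycles. The
    walk from [a] follows [f] until it would enter [b], is sent to [c], runs once around the cycle
    of [c], and is then sent to [b]. *)
Lemma orbit_merge (A : finType) (f g : A -> A) a b c :
  injective f -> a != b -> b \in orbit f a -> c \notin orbit f a ->
  (forall y, g y = if f y == b then c else if f y == c then b else f y) ->
  orbit g a = insert_before b (orbit f c) (orbit f a).
Proof.
move=> f_inj ab b_a c_a gE.
have cyc y : exists2 s, orbit f y = y :: s &
    [/\ fpath f y s, f (last y s) = y & uniq (y :: s)].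
  exists (behead (orbit f y)).
    by rewrite /orbit; case: (fingraph.order f y) (fingraph.order_gt0 f y).
  have := cycle_orbit f_inj y; have := orbit_uniq f y.
  rewrite /orbit; case: (fingraph.order f y) (fingraph.order_gt0 f y) => //= n _ ->.
  by rewrite rcons_path /= => /andP[-> /eqP].
have [sa def_a [pa la Ua]] := cyc a; have [sc def_c [pc lc Uc]] := cyc c.
have disj y : y \in orbit f c -> y \notin orbit f a.
  rewrite -!fconnect_orbit => cy; apply: contra c_a => ay.
  rewrite -fconnect_orbit; apply: connect_trans ay _.
  by rewrite fconnect_sym.
have b_sa : b \in sa by move: b_a; rewrite def_a inE eq_sym (negPf ab).
rewrite def_c def_a; rewrite def_a def_c in disj; rewrite def_a in c_a.
case/splitPr: b_sa pa la Ua disj c_a => s1 s2 pa la Ua disj c_a.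
have -> : insert_before b (c :: sc) (a :: s1 ++ b :: s2) = a :: s1 ++ c :: sc ++ b :: s2.
  have b1 : b \notin a :: s1.
    by move: Ua; rewrite -cat_cons uniq_catC /= mem_cat => /andP[]; rewrite negb_or => /andP[].
  rewrite /insert_before -cat_cons index_cat (negPf b1) /= eqxx addn0.
  by rewrite take_size_cat // drop_size_cat.
have Ug : uniq (a :: s1 ++ c :: sc ++ b :: s2).
  rewrite -[X in uniq X]/((a :: s1) ++ (c :: sc) ++ b :: s2) uniq_catCA cat_uniq.
  by apply/and3P; split=> //; apply/hasPn=> y; apply: contraL; apply: disj.
apply: orbit_fcycle => //.
move: pa la; rewrite cat_path last_cat /= => /and3P[p1 /eqP l1 p2] l2.
have ab' : b != c by apply: contraNneq c_a => <-; rewrite -cat_cons mem_cat mem_head orbT.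
have gN (s : seq A) : b \notin s -> c \notin s -> forall y, f y \in s -> g y = f y.
  move=> bs cs y ys; rewrite gE; case: eqP ys => [->|_]; first by rewrite (negPf bs).
  by case: eqP => [->|//]; rewrite (negPf cs).
have Nb : (b \notin a :: s1) && (b \notin s2).
  by move: Ua; rewrite -cat_cons uniq_catC /= mem_cat negb_or => /andP[/andP[-> ->]].
have Nc : (c \notin a :: s1) && (c \notin s2).
  by move: c_a; rewrite -cat_cons mem_cat !inE !negb_or => /and3P[-> _ ->].
have Nbc : b \notin c :: sc by apply/negP=> /disj; rewrite -cat_cons mem_cat mem_head orbT.
case/andP: Nb; rewrite inE negb_or => /andP[ba b1] b2.
case/andP: Nc; rewrite inE negb_or => /andP[ca c1] c2.
rewrite /= rcons_path !cat_path /= cat_path last_cat /= last_cat /=.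
rewrite (fpath_eq (gN _ b1 c1) p1) /= gE l1 eqxx eqxx /=.
rewrite (fpath_eq (gN sc _ _) pc) /=; last 2 first.
- by move: Nbc; rewrite inE negb_or => /andP[].
- by case/andP: Uc.
rewrite gE lc [c == b]eq_sym (negPf ab') !eqxx /= (fpath_eq (gN _ b2 c2) p2) /=.
by rewrite gE l2 (negPf ab) [a == c]eq_sym (negPf ca).
Qed.


Lemma index_insert_old (A : eqType) (b a : A) m s : a \in s -> a \notin m ->
  index a (insert_before b m s) =
    (index a s + (if index a s < index b s then 0 else size m))%N.
Proof.
move=> a_s am; have := erefl (index a s).
rewrite -{2}(cat_take_drop (index b s) s) /insert_before !index_cat (negPf am).
by rewrite in_take //; case: ltnP => _; lia.
Qed.

Lemma index_insert_new (A : eqType) (b a : A) m s : a \in m -> a \notin s ->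
  (index b s <= index a (insert_before b m s) < index b s + size m)%N.
Proof.
move=> am a_s; rewrite /insert_before !index_cat am (contraNF (@mem_take _ _ _ _)) //.
rewrite size_takel ?index_size //; have := index_mem a m; rewrite am.
lia.
Qed.

(** Filtering preserves relative order, so positions in the tour can be compared in the whole
    contour. *)
Lemma index_filter_pmap (A : eqType) (P : pred A) (s : seq (option A)) a b :
  P a -> P b ->
  (index a (filter P (pmap id s)) < index b (filter P (pmap id s)))%N =
  (index (Some a) s < index (Some b) s)%N.
Proof.
move=> Pa Pb; elim: s => //= -[y|] s IHs //=.
have eqS y' : (Some y == Some y') = (y == y') by [].
rewrite !eqS; case: ifPn => /= Py; first by case: (y == a); case: (y == b).
have yF y' : P y' -> (y == y') = false by move=> Py'; apply: contraNF Py => /eqP->.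
by rewrite !yF.
Qed.

(** * Contour and goodness along a growth *)

Section TourGrowth.
Variables (G : digraph) (M : rooted_map G).
Implicit Types (d : dart G) (t : seq (dart G)) (T : {set edge G}) (h : xdart G).

Notation r := (Defs.root M).
Notation top := (@dart_vertex G).
Notation bot := (fun d => dart_vertex (opp_dart d)).
Notation reached := (verts top r).
Notation growth := (grows top bot r).

(** The whole closed walk, with tree darts and the external dart, so that attaching a vertex is a
    plain insertion. *)
Definition contour t := orbit (tour_step M (tree_of t)) None.

Lemma mem_orbit_rotation h h' :
  (h' \in orbit (rotation M) h) = (xdart_vertex r h' == xdart_vertex r h).
Proof.
have := rotation_orbits M h => /setP/(_ h'); rewrite inE => <-.
rewrite -fconnect_orbit; apply/idP/porbitP => [/iter_findex <-|[i ->]].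
  by exists (findex (rotation M) h h'); rewrite permX.
by rewrite permX fconnect_iter.
Qed.

(** Adding an edge composes the step with the transposition of its two darts, the situation of
    [orbit_merge]. *)
Lemma tour_step_add d T h : d.1 \notin T ->
  tour_step M (d.1 |: T) h =
    let h' := tour_step M T h in
    if h' == Some (opp_dart d) then Some d
    else if h' == Some d then Some (opp_dart d) else h'.
Proof.
move=> dT; rewrite /tour_step /=; case: (rotation M h) => [y|] //=.
rewrite !inE; case: eqP => [yd|yd] /=; last first.
  by case: ifP => _; do 2!case: eqP => [/Some_inj/(congr1 fst)//|_].
rewrite yd (negPf dT).
case: (dart_eq_edge yd) => ->; last by rewrite eqxx opp_dartK.
by rewrite eqxx (inj_eq Some_inj) eq_sym (negPf (opp_dart_neq d)).
Qed.

(** No tree edge touches the new vertex, so the walk there never crosses. *)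
Lemma orbit_tour_new d t : growth t -> top d \notin reached t ->
  orbit (tour_step M (tree_of t)) (Some d) = orbit (rotation M) (Some d).
Proof.
move=> gt dt.
have [s def_s] : exists s, orbit (rotation M) (Some d) = Some d :: s.
  exists (behead (orbit (rotation M) (Some d))).
  by rewrite /orbit; case: (fingraph.order _ _) (fingraph.order_gt0 (rotation M) (Some d)).
have := cycle_orbit (@perm_inj _ (rotation M)) (Some d).
have := orbit_uniq (rotation M) (Some d); rewrite def_s => Us ps.
apply: orbit_fcycle => //; apply: fpath_eq ps => h; rewrite mem_rcons -def_s.
rewrite mem_orbit_rotation /tour_step; case: (rotation M h) => //= y /eqP yd.
by rewrite (negPf (growth_new_edge gt _)) // yd.
Qed.

Lemma tour_step0 : tour_step M (tree_of [::]) =1 rotation M.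
Proof. by move=> h; rewrite /tour_step; case: (rotation M h) => //= d; rewrite inE. Qed.

(** The two claims are proved together: membership says that [opp_dart d] is on the old contour and
    [d] is not, as the merging of cycles requires. *)
Lemma contourP t : growth t ->
  (forall h, (h \in contour t) = (xdart_vertex r h \in reached t)) /\
  if t is d :: t' then contour t =
    insert_before (Some (opp_dart d)) (orbit (rotation M) (Some d)) (contour t')
  else true.
Proof.
elim: t => [|d t IHt].
  split=> // h; rewrite -fconnect_orbit (eq_fconnect tour_step0) fconnect_orbit.
  by rewrite mem_orbit_rotation inE.
move=> /= /and3P[dt pd gt]; have [memt _] := IHt gt.
have dT := growth_new_edge gt dt.
have def_c : contour (d :: t) =
    insert_before (Some (opp_dart d)) (orbit (rotation M) (Some d)) (contour t).
  rewrite -(orbit_tour_new gt dt); apply: orbit_merge => //.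
  - exact: tour_step_inj.
  - by rewrite memt.
  - by rewrite memt.
  by move=> h; rewrite tree_of_cons tour_step_add.
split=> // h; rewrite def_c /insert_before !mem_cat orbCA -mem_cat cat_take_drop.
by rewrite mem_orbit_rotation memt inE.
Qed.

Lemma mem_contour t h : growth t -> (h \in contour t) = (xdart_vertex r h \in reached t).
Proof. by case/contourP. Qed.

Lemma contour_cons d t : growth (d :: t) ->
  contour (d :: t) =
    insert_before (Some (opp_dart d)) (orbit (rotation M) (Some d)) (contour t).
Proof. by case/contourP. Qed.

(** [d2.2] says that the edge of [d2] enters the new vertex. As the darts of that vertex are
    inserted just before [opp_dart d], such an edge is well ordered exactly when its old dart
    precedes [opp_dart d]. *)
Definition good_step d t : bool :=
  [forall d2, [&& top d2 == top d, bot d2 \in reached t & d2 != d] ==>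
    ((index (Some (opp_dart d2)) (contour t) <
      index (Some (opp_dart d)) (contour t))%N == d2.2)].

Fixpoint good_growth t : bool :=
  if t is d :: t' then good_step d t' && good_growth t' else true.

Hypothesis loopless : forall e : edge G, origin e != target e.

Lemma top_bot d : top d != bot d.
Proof. by case: d => e []; rewrite /dart_vertex //= eq_sym. Qed.

Definition ordered_edge t (e : edge G) : bool :=
  (index (Some (e, false)) (contour t) < index (Some (e, true)) (contour t))%N.

(** An edge is tested when its second end is reached: later insertions do not change the relative
    order of darts already on the contour. *)
Lemma good_growthP t : growth t ->
  reflect (forall e, e \notin tree_of t -> origin e \in reached t ->
             target e \in reached t -> ordered_edge t e)
          (good_growth t).
Proof.
elim: t => [_|d t IHt] /=.
  left=> e _; rewrite !inE => /eqP oe /eqP te.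
  by have := loopless e; rewrite oe te eqxx.
case/and3P=> dt pd gt.
have gdt : growth (d :: t) by rewrite /= dt pd.
have inC y : top y \in reached t -> index (Some y) (contour (d :: t)) =
    (index (Some y) (contour t) +
     (if index (Some y) (contour t) < index (Some (opp_dart d)) (contour t)
      then 0 else size (orbit (rotation M) (Some d))))%N.
  move=> yt; rewrite contour_cons // index_insert_old ?mem_contour //.
  by rewrite mem_orbit_rotation /=; apply: contraNneq dt => <-.
have ninC y : top y = top d ->
    (index (Some (opp_dart d)) (contour t) <= index (Some y) (contour (d :: t)) <
     index (Some (opp_dart d)) (contour t) + size (orbit (rotation M) (Some d)))%N.
  move=> yt; rewrite contour_cons // index_insert_new ?mem_contour //= ?yt //.
  by rewrite mem_orbit_rotation /= yt.
have stepP d2 : top d2 = top d -> bot d2 \in reached t ->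
    ordered_edge (d :: t) d2.1 =
    ((index (Some (opp_dart d2)) (contour t) <
      index (Some (opp_dart d)) (contour t))%N == d2.2).
  case: d2 => e b td bd; have := inC _ bd; have := ninC _ td.
  move: td bd; rewrite /ordered_edge /opp_dart; case: b => /= _ _;
  move: (index _ (contour (d :: t))) (index (Some (e, true)) (contour (d :: t)))
    (index (Some (e, _)) (contour t)) (index _ (contour t)) (size _) => i1 i2 i3 i4 n;
  rewrite ?eqb_id ?eqbF_neg; case: (ltnP i3 i4); lia.
have oldP e : origin e \in reached t -> target e \in reached t ->
    ordered_edge (d :: t) e = ordered_edge t e.
  move=> oet tet; have /= := inC (e, false) oet; have /= := inC (e, true) tet.
  rewrite /ordered_edge => -> ->.
  move: (index (Some (e, false)) _) => i1; move: (index (Some (e, true)) _) => i2.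
  move: (index _ _) (size _) => i3 n; case: (ltnP i1 i3); case: (ltnP i2 i3); lia.
apply: (iffP andP) => [[gs gg] e | ord].
  rewrite tree_of_cons !inE negb_or => /andP[ed eT].
  have new d2 : d2.1 = e -> top d2 = top d -> bot d2 \in reached t ->
      ordered_edge (d :: t) e.
    move=> d2e td bd; rewrite -d2e stepP //; have /forallP/(_ d2)/implyP := gs; apply.
    by rewrite td eqxx bd /=; apply: contraNneq ed => <-; rewrite d2e.
  case/orP=> [/eqP od|oe] /orP[/eqP te|te].
  - by have := loopless e; rewrite od te eqxx.
  - exact: (new (e, false) erefl od te).
  - exact: (new (e, true) erefl te oe).
  by rewrite oldP //; apply: (elimT (IHt gt)) => //; rewrite inE.
split; last first.
  apply/(IHt gt) => e eT oe te; rewrite -oldP //; apply: ord; rewrite ?inE ?oe ?te ?orbT //.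
  rewrite inE in eT; rewrite negb_or eT andbT; apply: contraNneq dt => ed.
  by rewrite /dart_vertex -ed; case: ifP.
apply/forallP=> d2; apply/implyP=> /and3P[/eqP td bd d2d].
rewrite -stepP //; apply: ord.
- rewrite tree_of_cons in_setU1 negb_or (growth_new_edge gt) ?td // andbT.
  apply: contraNneq d2d => /dart_eq_edge[->|d2o] //.
  by have := top_bot d; rewrite -td d2o eqxx.
- by move: td bd; case: (d2) => e [] /= <- bd; rewrite inE ?bd ?eqxx ?orbT.
by move: td bd; case: (d2) => e [] /= <- bd; rewrite inE ?bd ?eqxx ?orbT.
Qed.

Lemma good_tree_of t : growth t -> (forall v, v \in reached t) ->
  good M (tree_of t) = good_growth t.
Proof.
move=> gt full; apply/forallP/(good_growthP gt) => [gT e eT _ _ | ord e].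
  by have := implyP (gT e) eT; rewrite index_filter_pmap.
by apply/implyP=> eT; rewrite index_filter_pmap //; apply: ord.
Qed.

End TourGrowth.

(** * Signed count of good trees *)

(* The signs must read [+ ... + ? - ... -]; when both occur, the two choices of
   [?] cancel. *)
Lemma sum_sign_pattern (R : pzRingType) (A : eqType) (b : pred A) (s : seq A) :
  uniq s ->
  \sum_(a <- s | all (fun a' => (a' != a) ==> ((index a' s < index a s)%N == b a')) s)
    (-1) ^+ (~~ b a) = (all b s)%:R - (all (predC b) s)%:R :> R.
Proof.
elim: s => [|y s IHs] /=; first by rewrite big_nil subrr.
case/andP=> ys Us; have yF a : a \in s -> (y == a) = false /\ (a == y) = false.
  by move=> a_s; rewrite eq_sym; have /negPf-> := memPn ys _ a_s.
(* Choosing the first element [y] forces [b] to fail on all the others; choosing a later one forces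
   [b y] and leaves the same pattern on [s]. *)
rewrite big_cons eqxx /= (@eq_in_all _ _ (predC b)) => [|a /yF[-> ->] /=]; last first.
  by rewrite ltn0; case: (b a).
rewrite [X in if _ then _ + X else X](_ : _ = if b y then
    (all b s)%:R - (all (predC b) s)%:R else 0); last first.
  rewrite -IHs // big_seq_cond; case: (boolP (b y)) => by_; last first.
    by rewrite big_pred0 // => a; case: (boolP (a \in s)) => // /yF[-> _].
  rewrite [RHS]big_seq_cond; apply: eq_bigl => a.
  case: (boolP (a \in s)) => //= /yF[ya ay]; rewrite ya /=.
  by apply: eq_in_all => a' /yF[-> _].
case: (b y); case: (all (predC b) s); rewrite /= ?expr1 ?addr0 ?subr0 ?sub0r ?oppr0 //.
by rewrite expr0 addrC subrK.
Qed.

(** * Weights of vertex orders *)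

Section Weights.
Variables (R : comPzRingType) (G : digraph) (M : rooted_map G).
Implicit Types (d : dart G) (t : seq (dart G)) (z : vertex G) (s w : seq (vertex G)).

Notation r := (Defs.root M).
Notation top := (@dart_vertex G).
Notation bot := (fun d => dart_vertex (opp_dart d)).
Notation reached := (verts top r).
Notation growth := (grows top bot r).

Definition back w z : pred (dart G) := [pred d | (top d == z) && (bot d \in w)].

(** [d.2] says that the edge enters [z]. With no edge between [z] and [w] both indicators are 1 and
    the weight vanishes. *)
Definition step_weight w z : R :=
  [forall (d | back w z d), d.2]%:R - [forall (d | back w z d), ~~ d.2]%:R.

Fixpoint weight s : R :=
  if s is z :: s' then step_weight (rcons s' r) z * weight s' else 1.

(** Compares the edge with its direction from parent to child in a growth: +1 when the edge enters
    the child. *)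
Definition dart_sign d : R := (-1) ^+ (~~ d.2).

Fixpoint lifts s : seq (seq (dart G)) :=
  if s is z :: s' then
    [seq d :: t | t <- lifts s', d <- enum (back (rcons s' r) z)]
  else [:: [::]].

Lemma mem_lifts s t : uniq (rcons s r) ->
  (t \in lifts s) = (map top t == s) && growth t.
Proof.
elim: s t => [|z s IHs] t /=.
  by rewrite inE; case: t.
case/andP=> zs Us; apply/allpairsP/andP=> [[[t' d] /= []]|].
  rewrite IHs // => /andP[/eqP def_s gt']; rewrite mem_enum inE => /andP[/eqP dz bd] ->.
  by rewrite /= dz vertsE def_s zs bd gt' !eqxx.
case: t => [|d t] [] // /eqP[dz def_s] /and3P[dt bd gt].
exists (t, d); split=> //=; first by rewrite IHs // def_s eqxx.
by rewrite mem_enum inE dz eqxx -def_s -vertsE.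
Qed.

Lemma uniq_lifts s : uniq (lifts s).
Proof.
elim: s => //= z s IHs; apply: allpairs_uniq => //; first exact: enum_uniq.
by move=> [t d] [t' d'] _ _ /= [-> ->].
Qed.

(** List the opposite darts of the candidates in contour order: [good_step] is then the pattern of
    [sum_sign_pattern], whose signed count does not depend on the order. *)
Lemma sum_good_step t z : growth t -> z \notin reached t ->
  \sum_(d <- enum (back (reached t) z) | good_step M d t) dart_sign d =
    step_weight (reached t) z.
Proof.
move=> gt zt.
pose P : pred (dart G) := [pred d | top (opp_dart d) == z].
pose X := filter P (pmap id (contour M t)).
have memX d : (d \in X) = back (reached t) z (opp_dart d).
  by rewrite mem_filter mem_pmap map_id mem_contour //= /back /= opp_dartK.
have UX : uniq X.
  apply: filter_uniq; apply: (@pmap_uniq _ _ _ Some); first by case.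
  exact: orbit_uniq.
have opp_inj := inv_inj (@opp_dartK G).
have allX (b : pred (dart G)) :
    [forall (d | back (reached t) z d), b d] = all (fun y => b (opp_dart y)) X.
  apply/forall_inP/allP => [bP y | bP d dz]; first by rewrite memX => /bP.
  by rewrite -[d]opp_dartK bP // memX opp_dartK.
rewrite (perm_big (map (@opp_dart G) X)) /=; last first.
  apply: uniq_perm; rewrite ?enum_uniq ?map_inj_uniq // => d.
  by rewrite mem_enum -{2}[d]opp_dartK mem_map // memX opp_dartK.
rewrite /step_weight !allX -sum_sign_pattern // big_map big_seq_cond [RHS]big_seq_cond.
apply: eq_big => // y; case: (boolP (y \in X)) => //= yX.
have PX y' : y' \in X -> P y' by rewrite mem_filter => /andP[].
have eX y' : y' \in X ->
    (index (Some y') (contour M t) < index (Some y) (contour M t))%N =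
    (index y' X < index y X)%N.
  by move=> y'X; rewrite index_filter_pmap ?PX.
apply/forallP/allP => [gP y' y'X | gP d2].
  have := gP (opp_dart y'); rewrite !opp_dartK (inj_eq opp_inj) eX //.
  by have /eqP-> := PX _ y'X; have /eqP-> := PX _ yX; rewrite eqxx;
    move: y'X; rewrite memX => /andP[_]; rewrite opp_dartK => ->.
apply/implyP=> /and3P[/eqP td bd d2y]; have yz := eqP (PX _ yX).
have d2X : opp_dart d2 \in X by rewrite memX opp_dartK /back /= td yz eqxx.
have := gP _ d2X; rewrite opp_dartK -eX // (_ : opp_dart d2 != y) ?opp_dartK //.
  by rewrite /= negbK.
by apply: contraNneq d2y => <-; rewrite opp_dartK.
Qed.

(** The signed count of each step depends on the reached vertices only, not on the growth chosen so
    far, so the sum factors. *)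
Lemma sum_good_lifts s : uniq (rcons s r) ->
  \sum_(t <- lifts s | good_growth M t) \prod_(d <- t) dart_sign d = weight s.
Proof.
elim: s => [|z s IHs] /=; first by rewrite big_cons /= !big_nil addr0.
case/andP=> zs Us; rewrite big_mkcond big_allpairs_dep /= -IHs // big_distrr /=.
rewrite [RHS]big_mkcond; apply: eq_big_seq => t; rewrite mem_lifts // => /andP[/eqP def_s gt].
have rt : rcons s r = reached t by rewrite vertsE def_s.
rewrite -big_mkcond rt -sum_good_step -?rt //; case: (good_growth M t); last first.
  by rewrite big_pred0 // => d; rewrite andbF.
by rewrite mulr_suml; apply: eq_big => [d|d _]; rewrite ?andbT // big_cons.
Qed.

End Weights.

(** * Words spread around the root *)

Section Spread.
Variables (V : eqType) (r : V).
Implicit Types (s w : seq V) (v z : V).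

Fixpoint spread s : seq (seq V) :=
  if s is z :: s' then map (cons z) (spread s') ++ map (rcons^~ z) (spread s')
  else [:: [:: r]].

(* The neighbour of [v] on the side of [r]. *)
Definition inward w v :=
  if (index v w < index r w)%N then nth r w (index v w).+1
  else nth r w (index v w).-1.

Lemma spreadP s z w : reflect
  (exists2 w', w' \in spread s & w = z :: w' \/ w = rcons w' z)
  (w \in spread (z :: s)).
Proof.
rewrite mem_cat; apply: (iffP orP) => [[] /mapP[w' w's ->]|[w' w's [] ->]].
- by exists w' => //; left.
- by exists w' => //; right.
- by left; apply: map_f.
by right; apply: (map_f (rcons^~ z)).
Qed.

Lemma spread_perm s w : w \in spread s -> perm_eq w (rcons s r).
Proof.
elim: s w => [|z s IHs] w; first by rewrite inE => /eqP->.
case/spreadP=> w' /IHs w's [] ->; first by rewrite /= perm_cons.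
by rewrite perm_rcons perm_cons.
Qed.

Lemma spread_root s w : w \in spread s -> r \in w.
Proof. by move/spread_perm/perm_mem->; rewrite mem_rcons mem_head. Qed.

Lemma uniq_spread s : uniq (rcons s r) -> uniq (spread s).
Proof.
elim: s => //= z s IHs /andP[zs Us].
have [cI rI] : injective (cons z) /\ injective (rcons^~ z).
  by split=> [w w' [] | w w' /rcons_inj[]].
rewrite cat_uniq !map_inj_uniq ?IHs //= andbT.
apply/hasPn=> w /mapP[w' w's ->]; apply/mapP=> -[w2 w2s].
case: w' w's => [|a w'] w's /=; first by have := spread_root w's.
case=> az _; have := perm_mem (spread_perm w's) z.
by rewrite az mem_head (negPf zs).
Qed.

Lemma inward_cons z w v : z \notin w -> r \in w -> v \in w -> v != r ->
  inward (z :: w) v = inward w v.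
Proof.
move=> zw rw vw vr; rewrite /inward /=.
have zF u : u \in w -> (z == u) = false by move=> uw; apply: contraNF zw => /eqP->.
rewrite !zF // ltnS; case: ltnP => //= rv.
(* The predecessor truncates only at index 0, where [r] would also be in front and [v] would be
   [r]. *)
case def_i: (index v w) rv => [|i] //= rv0.
case/eqP: vr; rewrite -(nth_index r vw) -[RHS](nth_index r rw) def_i.
by move: rv0; rewrite leqn0 => /eqP->.
Qed.

Lemma inward_rcons z w v : z \notin w -> r \in w -> v \in w -> v != r ->
  inward (rcons w z) v = inward w v.
Proof.
move=> zw rw vw vr; rewrite /inward -cats1 !index_cat vw rw !nth_cat.
have := index_mem v w; have := index_mem r w; rewrite rw vw => ri vi.
case: ltnP => rv; first by rewrite (leq_ltn_trans rv ri).
by rewrite (leq_ltn_trans (leq_pred _) vi).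
Qed.

Lemma inward_head z w : z \notin w -> r \in w -> inward (z :: w) z = head r w.
Proof.
move=> zw rw; rewrite /inward /= eqxx (_ : (z == r) = false) //= ?nth0 //.
by apply: contraNF zw => /eqP->.
Qed.

Lemma inward_last z w : z \notin w -> r \in w -> inward (rcons w z) z = last r w.
Proof.
move=> zw rw; rewrite /inward -cats1 !index_cat (negPf zw) rw /= eqxx addn0.
have ri := rw; rewrite -index_mem in ri.
rewrite ltnNge (ltnW ri) /= nth_cat.
by case: (w) ri => [|a w'] // _; rewrite /= ltnSn (last_nth r).
Qed.

Lemma grows_eq_in (f g : V -> V) s :
  {in s, f =1 g} -> grows id f r s = grows id g r s.
Proof.
elim: s => //= z s IHs fg; rewrite fg ?mem_head // IHs // => v vs.
by rewrite fg // inE vs orbT.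
Qed.

(** View [w] as a path hanging from [r], with parents given by [inward w]: its increasing orders are
    the ways to build it outward, since the latest letter is a leaf of the path, that is, an end of
    [w]. *)
Lemma mem_spread s w : uniq w ->
  (w \in spread s) = perm_eq w (rcons s r) && grows id (inward w) r s.
Proof.
have vE u : verts id r u = rcons u r by rewrite vertsE map_id.
elim: s w => [|z s IHs] w Uw.
  rewrite inE andbT; apply/eqP/idP=> [-> //|]; exact: perm_small_eq.
apply/idP/andP => [ws|[pw /= /and3P[zs pz gs]]].
  have pw := spread_perm ws; split=> //; have Us := Uw.
  rewrite (perm_uniq pw) rcons_cons cons_uniq in Us.
  case/andP: Us => zs Us; case/spreadP: ws => w' w's def_w; have pw' := spread_perm w's.
  have zw' : z \notin w' by rewrite (perm_mem pw').
  have rw' := spread_root w's.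
  have Uw' : uniq w' by rewrite (perm_uniq pw').
  have := w's; rewrite IHs // => /andP[_ gs].
  have s_w v : v \in s -> v \in w' /\ v != r.
    move=> vs; rewrite (perm_mem pw') mem_rcons inE vs orbT; split=> //.
    by move: Us; rewrite rcons_uniq => /andP[rs _]; apply: contraNneq rs => <-.
  rewrite /= vE zs /= -(perm_mem pw').
  case: def_w => ->.
    rewrite inward_head // (_ : head r w' \in w') /=; last first.
      by case: (w') rw' => //= a ? _; rewrite mem_head.
    rewrite (grows_eq_in (g := inward w')) // => v /s_w[vw vr]; exact: inward_cons.
  rewrite inward_last // (_ : last r w' \in w') /=; last first.
    by case: (w') rw' => //= a ? _; rewrite mem_last.
  rewrite (grows_eq_in (g := inward w')) // => v /s_w[vw vr]; exact: inward_rcons.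
rewrite vE in zs pz.
have zw : z \in w by rewrite (perm_mem pw) mem_head.
have rw : r \in w by rewrite (perm_mem pw) inE mem_rcons mem_head orbT.
have zr : z != r by apply: contraNneq zs => ->; rewrite mem_rcons mem_head.
have leaf v : v \in w -> v != z -> v != r -> inward w v != z.
  rewrite (perm_mem pw) inE => /orP[->//|]; rewrite mem_rcons inE => /orP[->//|vs _ _].
  by apply: contraNneq zs => <-; rewrite -vE; apply: grows_parent.
have [w' def_w] : exists w', w = z :: w' \/ w = rcons w' z.
  have zi := zw; rewrite -index_mem in zi.
  have [i0|i0] := posnP (index z w).
    case: (w) zw i0 => // a w' _ /=; case: eqP => [-> _|] //.
    by exists w'; left.
  have [iw|iw] := ltnP (index z w).+1 (size w); last first.
    exists (take (index z w) w); right.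
    rewrite -{1}(cat_take_drop (index z w) w) (drop_nth r) // nth_index //.
    by rewrite drop_oversize // cats1.
  have neq_i : index r w != index z w.
    by apply: contraNneq zr => ei; rewrite -(nth_index r zw) -ei nth_index.
  have leaf_i j : (j < size w)%N -> j != index z w -> j != index r w ->
      inward w (nth r w j) != z.
    move=> jw jz jr; apply: leaf; first exact: mem_nth.
      by apply: contraNneq jz => <-; rewrite index_uniq.
    by apply: contraNneq jr => <-; rewrite index_uniq.
  (* An interior [z] would be the inward neighbour of the letter next to it on the side away from
     [r], contradicting [leaf]. *)
  have [zr_i|rz_i] := ltnP (index z w) (index r w).
    have := leaf_i (index z w).-1; rewrite /inward index_uniq //; last by lia.
    rewrite (ltn_trans _ zr_i) ?prednK // nth_index // eqxx => /(_ _ _ _)/negP[] //; lia.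
  have := leaf_i (index z w).+1; rewrite /inward index_uniq //.
  rewrite ifF; last by lia.
  by rewrite nth_index // eqxx => /(_ _ _ _)/negP[] //; lia.
apply/spreadP; exists w' => //.
have pw' : perm_eq w' (rcons s r).
  rewrite -(perm_cons z); apply: perm_trans pw; case: def_w => -> //.
  by rewrite perm_sym perm_rcons.
have zw' : z \notin w' by rewrite (perm_mem pw').
have Uw' : uniq w'.
  by case: def_w Uw => ->; rewrite ?rcons_uniq /= => /andP[].
rewrite IHs // pw' /=; move: gs; congr (is_true _); apply: grows_eq_in => v vs.
have rw' : r \in w' by rewrite (perm_mem pw') mem_rcons mem_head.
have vw' : v \in w' by rewrite (perm_mem pw') mem_rcons inE vs orbT.
have vr : v != r.
  move: Uw'; rewrite (perm_uniq pw') rcons_uniq => /andP[rs _].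
  by apply: contraNneq rs => <-.
by case: def_w => ->; rewrite ?inward_cons ?inward_rcons.
Qed.

End Spread.

(** * Linear extensions *)

Section WordProduct.
Variables (F : fieldType) (V : eqType) (x : V -> F) (r : V).
Hypothesis x_inj : injective x.
Implicit Types (s w : seq V) (z : V).

Definition word_prod w : F :=
  \prod_(p <- zip w (behead w)) (x p.1 - x p.2)^-1.

Lemma word_prod_cons z w : w != [::] ->
  word_prod (z :: w) = (x z - x (head r w))^-1 * word_prod w.
Proof. by case: w => // a w _; rewrite /word_prod /= big_cons. Qed.

Lemma word_prod_rcons z w : w != [::] ->
  word_prod (rcons w z) = word_prod w * (x (last r w) - x z)^-1.
Proof.
elim: w => // a [|b w] IHw _.
  by rewrite /word_prod /= big_seq1 big_nil mul1r.
rewrite rcons_cons word_prod_cons; last by rewrite -size_eq0 size_rcons.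
by rewrite IHw // [in RHS]word_prod_cons //= mulrA.
Qed.

(** The outward direction agrees with the reading direction to the right of [r]; each of the
    [index r w] letters to its left costs a sign. *)
Lemma prod_inward s w : uniq w -> w \in spread r s ->
  \prod_(v <- s) (x (inward r w v) - x v)^-1 = (-1) ^+ index r w * word_prod w.
Proof.
elim: s w => [|z s IHs] w Uw.
  by rewrite inE => /eqP->; rewrite /word_prod /= eqxx !big_nil mulr1.
move=> ws; have pw := spread_perm ws; move: ws => /spreadP[w' w's def_w].
have := Uw; rewrite (perm_uniq pw) rcons_cons cons_uniq rcons_uniq.
case/and3P=> zs rs Us; have pw' := spread_perm w's.
have zw' : z \notin w' by rewrite (perm_mem pw').
have rw' := spread_root w's.
have Uw' : uniq w' by rewrite (perm_uniq pw') rcons_uniq rs.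
have w'0 : w' != [::] by case: (w') rw'.
have sP v : v \in s -> [/\ v \in w' & v != r].
  move=> vs; rewrite (perm_mem pw') mem_rcons inE vs orbT; split=> //.
  by apply: contraNneq rs => <-.
have zr : (z == r) = false by apply: contraNF zw' => /eqP->.
rewrite big_cons; case: def_w => def_w; rewrite {w}def_w in Uw pw *.
  rewrite inward_head // word_prod_cons //= zr exprS -mulrA [X in -1 * X]mulrCA.
  rewrite -IHs // mulN1r -mulNr -invrN opprB; congr (_ * _); apply: eq_big_seq => v.
  by case/sP=> *; rewrite inward_cons.
rewrite inward_last // word_prod_rcons // -cats1 index_cat rw' cats1 mulrA -IHs //.
rewrite mulrC; congr (_ * _); apply: eq_big_seq => v.
by case/sP=> *; rewrite inward_rcons.
Qed.

(** Letters are peeled off from the left until [r] comes first, then from the right. *)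
Lemma spread_exists w : r \in w -> exists s, w \in spread r s.
Proof.
elim/ltn_ind: {w}(size w) {-2}w (erefl (size w)) => n IHn w szw rw.
case: w rw szw => // a w; rewrite inE; case: eqP => [<- _|_ /= rw] szw.
  case/lastP: w szw => [|w z] szw; first by exists [::]; rewrite inE.
  have [||s ws] := IHn (size w).+1 _ (r :: w) _ (mem_head _ _) => //.
    by rewrite -szw /= size_rcons.
  by exists (z :: s); apply/spreadP; exists (r :: w) => //; right.
have [||s ws] := IHn (size w) _ w _ rw => //; first by rewrite -szw /=.
by exists (a :: s); apply/spreadP; exists w => //; left.
Qed.

(** This is [sum_exts] for the path [w], each letter serving as its own dart and [inward w] giving
    the parents. *)
Lemma word_prod_spread w : uniq w -> r \in w ->
  exists2 l : seq (seq V), uniq l /\ (forall s, (s \in l) = (w \in spread r s)) &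
    word_prod w = (-1) ^+ index r w * \sum_(s <- l) chain x (rcons s r).
Proof.
move=> Uw rw; have [s0 ws0] := spread_exists rw.
have := ws0; rewrite mem_spread // => /andP[pw gs0].
exists (exts id (inward r w) s0).
  split=> [|s]; first exact: uniq_exts gs0.
  rewrite (mem_exts _ gs0) mem_spread //; congr (_ && _).
  by rewrite (permPl pw) -!cats1 perm_cat2r perm_sym.
under eq_bigr => s _ do rewrite -[s in rcons s r]map_id -vertsE.
by rewrite (sum_exts x_inj gs0) prod_inward // mulrA -expr2 sqrr_sign mul1r.
Qed.

End WordProduct.

(** * Signed count of linear extensions built outward from the root *)

Section LinearExtensions.
Variables (R : comPzRingType) (G : digraph) (M : rooted_map G).
Hypothesis loopless : forall e : edge G, origin e != target e.
Implicit Types (d : dart G) (z : vertex G) (s w : seq (vertex G)).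

Notation r := (Defs.root M).

(** Tests only edges with both ends in [w], so that words can be extended letter by letter. *)
Definition lin_word w :=
  [forall e : edge G, (origin e \in w) && (target e \in w) ==>
    (index (origin e) w < index (target e) w)%N].

Lemma lin_word_cons z w : z \notin w ->
  lin_word (z :: w) = [forall (d | back w z d), ~~ d.2] && lin_word w.
Proof.
move=> zw; have zF u : u \in w -> (z == u) = false /\ (u == z) = false.
  by move=> uw; rewrite [u == z]eq_sym; split; apply: contraNF zw => /eqP->.
apply/forallP/andP => [lw | [/forall_inP bw /forallP lw] e].
  split; last first.
    apply/forallP=> e; apply/implyP=> /andP[oe te].
    have := lw e; rewrite /= !inE oe te !orbT /=.
    by have [-> _] := zF _ oe; have [-> _] := zF _ te.
  apply/forall_inP=> -[e b] /andP[/= /eqP tz bw]; case: b tz bw => //= tz bw.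
  have := lw e; move: tz bw; rewrite /dart_vertex /= => tz bw.
  by rewrite !inE tz bw eqxx orbT.
apply/implyP; rewrite !inE /= => /andP[/orP[/eqP oz|oe] /orP[/eqP tz|te]].
- by have := loopless e; rewrite oz tz eqxx.
- by rewrite oz eqxx; have [-> _] := zF _ te.
- by have := bw (e, true); rewrite /back /dart_vertex /= tz eqxx oe => /(_ isT).
by have [-> _] := zF _ te; have [-> _] := zF _ oe; have := lw e; rewrite oe te.
Qed.

Lemma lin_word_rcons z w : z \notin w ->
  lin_word (rcons w z) = [forall (d | back w z d), d.2] && lin_word w.
Proof.
move=> zw; have iw u : u \in w -> index u (rcons w z) = index u w.
  by move=> uw; rewrite -cats1 index_cat uw.
have iz : index z (rcons w z) = size w.
  by rewrite -cats1 index_cat (negPf zw) /= eqxx addn0.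
have iw_lt u : u \in w -> (index u w < size w)%N by rewrite index_mem.
apply/forallP/andP => [lw | [/forall_inP bw /forallP lw] e].
  split; last first.
    apply/forallP=> e; apply/implyP=> /andP[oe te].
    by have := lw e; rewrite !mem_rcons !inE oe te !orbT /= !iw.
  apply/forall_inP=> -[e b] /andP[/= /eqP tz bw]; case: b tz bw => //= tz bw.
  have := lw e; move: tz bw; rewrite /dart_vertex /= => tz bw.
  rewrite !mem_rcons !inE tz bw eqxx orbT iz iw //= => lt.
  by have := ltn_trans lt (iw_lt _ bw); rewrite ltnn.
apply/implyP; rewrite !mem_rcons !inE => /andP[/orP[/eqP oz|oe] /orP[/eqP tz|te]].
- by have := loopless e; rewrite oz tz eqxx.
- by have := bw (e, false); rewrite /back /dart_vertex /= oz eqxx te => /(_ isT).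
- by rewrite tz iz iw // iw_lt.
by rewrite !iw //; have := lw e; rewrite oe te.
Qed.

(** A letter put on the right needs its edges to earlier letters to enter it; on the left they must
    leave it, and [index r w] grows by one. This is the recursion of [weight]. *)
Lemma sum_lin_spread s : uniq (rcons s r) ->
  \sum_(w <- spread r s | lin_word w) (-1) ^+ index r w = weight R M s.
Proof.
elim: s => [|z s IHs] /=.
  move=> _; rewrite big_cons big_nil /= eqxx addr0 ifT //.
  apply/forallP=> e; apply/implyP; rewrite !inE => /andP[/eqP oe /eqP te].
  by have := loopless e; rewrite oe te eqxx.
case/andP=> zs Us; rewrite big_cat !big_map /= -IHs // /step_weight mulrBl addrC.
have wP w : w \in spread r s -> [/\ z \notin w, r \in w & w =i rcons s r].
  move=> ws; have := perm_mem (spread_perm ws) => mw.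
  by split=> //; [rewrite mw | apply: spread_root ws].
have bP w z' : w \in spread r s -> back w z' =1 back (rcons s r) z'.
  by case/wP=> _ _ mw d; rewrite /back /= mw.
congr (_ + _).
  rewrite big_distrr /= big_mkcond [RHS]big_mkcond; apply: eq_big_seq => w ws.
  have [zw rw mw] := wP _ ws; rewrite lin_word_rcons //.
  rewrite -(eq_forallb (fun d => congr1 (implb^~ d.2) (bP w z ws d))).
  rewrite -cats1 index_cat rw.
  by case: [forall _, _]; case: (lin_word w); rewrite ?mul1r ?mul0r.
rewrite -mulNr big_distrr /= big_mkcond [RHS]big_mkcond; apply: eq_big_seq => w ws.
have [zw rw mw] := wP _ ws; rewrite lin_word_cons //.
rewrite -(eq_forallb (fun d => congr1 (implb^~ (~~ d.2)) (bP w z ws d))).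
have -> : (z == r) = false by apply: contraNF zw => /eqP->.
by case: [forall _, _]; case: (lin_word w); rewrite ?exprS ?oppr0 ?mul0r.
Qed.

End LinearExtensions.

(** * Comparison of the expansions *)

(** Passing to a finite index type allows sums over lists to be exchanged and regrouped. *)
Lemma sum_seq_tuple (R : nmodType) (A : finType) k (l : seq (seq A)) (f : seq A -> R) :
  uniq l -> {in l, forall s, size s = k} ->
  \sum_(s <- l) f s = \sum_(s : k.-tuple A | tval s \in l) f s.
Proof.
move=> Ul szl; rewrite -big_enum -(big_map (@tval k A) predT f) /=.
apply: perm_big; apply: uniq_perm => //.
  by rewrite map_inj_uniq ?enum_uniq //; apply: val_inj.
move=> s; apply/idP/mapP => [ls | [s']]; last by rewrite mem_enum => s'l ->.
have /eqP szs := szl _ ls; exists (Tuple szs) => //.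
by rewrite mem_enum.
Qed.

Section Assembly.
Variables (G : digraph) (M : rooted_map G).
Hypothesis loopless : forall e : edge G, origin e != target e.

Notation r := (Defs.root M).
Notation V := (vertex G).
Notation top := (@dart_vertex G).
Notation bot := (fun d => dart_vertex (opp_dart d)).
Notation reached := (verts top r).
Notation growth := (grows top bot r).
Notation K := (ratfun G).
Notation x := (@xvar G).
Notation k := (#|V|.-1).

Lemma card_vertexS : k.+1 = #|V|.
Proof. by rewrite prednK //; apply/card_gt0P; exists r. Qed.

Lemma xvar_inj : injective x.
Proof.
move=> u v /eqP; rewrite /xvar tofrac_eq => /eqP eX.
apply: enum_rank_inj.
have := congr1 (fun p : {mpoly rat[#|V|]} => p@_U_(enum_rank u)) eX.
rewrite !mcoeffX eqxx; case: eqP => [/mnmP/(_ (enum_rank u))|_ /eqP].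
  by rewrite !mnm1E eqxx; case: eqP.
by rewrite oner_eq0.
Qed.

Lemma full_seq (s : seq V) : uniq s -> size s = #|V| -> forall v, v \in s.
Proof.
move=> Us szs v; have /subset_cardP : #|s| = #|V| by rewrite (card_uniqP Us).
by move/(_ (subset_predT _)) => ->.
Qed.

(** The common expansion of both sides, once divided by the product over all edges. *)
Definition root_expansion : K :=
  \sum_(s : k.-tuple V | uniq (rcons s r)) chain x (rcons s r) * weight K M s.

Lemma Psi_root_expansion : Psi G = root_expansion.
Proof.
rewrite /Psi.
transitivity (\sum_(w : #|V|.-tuple V | linear_extension w)
    \sum_(s : k.-tuple V | tval w \in spread r s) (-1) ^+ index r w * chain x (rcons s r)).
  apply: eq_bigr => w /andP[Uw _].
  have rw : r \in tval w by apply: full_seq => //; rewrite size_tuple.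
  have [l [Ul ml] def_w] := word_prod_spread xvar_inj Uw rw.
  rewrite -/(word_prod x w) def_w big_distrr /= (@sum_seq_tuple _ _ k) //.
    by apply: eq_bigl => s; rewrite ml.
  move=> s; rewrite ml => /spread_perm/perm_size.
  by rewrite size_rcons size_tuple => ->.
rewrite (exchange_big_dep predT) //= [RHS]big_mkcond /=; apply: eq_bigr => s _.
case: ifPn => Us; last first.
  rewrite big_pred0 // => w; apply: contraNF Us => /andP[/andP[Uw _] /spread_perm ws].
  by rewrite -(perm_uniq ws).
rewrite -big_distrl /= mulrC; congr (_ * _).
rewrite -(sum_lin_spread K loopless Us) -[RHS]big_filter.
rewrite (@sum_seq_tuple _ _ #|V|); last 2 first.
- by rewrite filter_uniq ?uniq_spread.
- move=> w; rewrite mem_filter => /andP[_ /spread_perm/perm_size->].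
  by rewrite size_rcons size_tuple card_vertexS.
apply: eq_bigl => w; rewrite mem_filter andbC [RHS]andbC.
case: (boolP (tval w \in _)) => //= ws.
have Uw : uniq w by rewrite (perm_uniq (spread_perm ws)).
rewrite /linear_extension Uw; apply: eq_forallb => e.
by rewrite !full_seq // size_tuple.
Qed.

Lemma uniq_growth_edges t : growth t -> uniq (map fst t).
Proof.
elim: t => //= d t IHt /and3P[dt _ gt]; rewrite IHt // andbT.
by have := growth_new_edge gt dt; rewrite inE.
Qed.

Lemma growth_full t : growth t -> size t = k -> forall v, v \in reached t.
Proof.
move=> gt szt; apply: full_seq; first exact: grows_uniq gt.
by rewrite vertsE size_rcons size_map szt card_vertexS.
Qed.

(** Directing the edges away from [r] produces the signs, and [sum_exts] expands the product for one
    growth of [T]. By [growth_same_tree], the reorderings of that growth are all the growths of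
    [T]. *)
Lemma tree_prod_expansion (T : {set edge G}) : spanning_tree T ->
  \prod_(e in T) (x (origin e) - x (target e))^-1 =
  \sum_(t : k.-tuple (dart G) | growth t && (tree_of t == T))
    \prod_(d <- t) dart_sign K d * chain x (reached t).
Proof.
case/(growth_exists r)=> t0 gt0 [full def_T].
have szt0 : size t0 = k.
  apply/succn_inj; rewrite card_vertexS -(size_map top) -(size_rcons _ r) -vertsE.
  by rewrite -(card_uniqP (grows_uniq gt0)); apply: eq_card.
have -> : \prod_(e in T) (x (origin e) - x (target e))^-1 =
    \prod_(d <- t0) dart_sign K d * \prod_(d <- t0) (x (bot d) - x (top d))^-1.
  rewrite -def_T (eq_bigl (mem (map fst t0))); last by move=> e; rewrite inE.
  rewrite -big_uniq ?uniq_growth_edges // big_map -big_split /=.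
  apply: eq_bigr => -[e b] _; rewrite /dart_sign /dart_vertex /=.
  by case: b; rewrite /= ?mul1r // mulN1r -invrN opprB.
rewrite -(sum_exts xvar_inj gt0) big_distrr /=.
rewrite (@sum_seq_tuple _ _ k); last 2 first.
- exact: uniq_exts gt0.
- by move=> t; rewrite (mem_exts _ gt0) => /andP[/perm_size->].
apply: eq_big => [t|t].
  rewrite (mem_exts _ gt0) andbC; case: (boolP (growth t)) => //= gt.
  apply/idP/eqP => [/tree_of_perm-> // | eT].
  by apply: (growth_same_tree gt gt0); rewrite ?def_T // size_tuple.
rewrite (mem_exts _ gt0) => /andP[pt _].
by rewrite (perm_big _ pt).
Qed.

Lemma good_tree_root_expansion :
  \sum_(T : {set edge G} | spanning_tree T && good M T)
    \prod_(e in T) (x (origin e) - x (target e))^-1 = root_expansion.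
Proof.
(* Each growth of full size determines its tree, so the double sum over good trees and their growths
   runs once over good growths. *)
transitivity (\sum_(t : k.-tuple (dart G) | growth t && good_growth M t)
    \prod_(d <- t) dart_sign K d * chain x (reached t)).
  rewrite (eq_bigr _ (fun T sT => tree_prod_expansion (andP sT).1)).
  rewrite (exchange_big_dep (fun t : k.-tuple _ => growth t && good_growth M t)) /=.
    apply: eq_bigr => t /andP[gt gg]; rewrite (big_pred1 (tree_of t)) // => T.
    rewrite gt /= [tree_of t == T]eq_sym; case: eqP => [->|_]; last by rewrite andbF.
    have full := growth_full gt (size_tuple t).
    by rewrite (growth_spanning_tree gt) ?good_tree_of ?gg.
  move=> T t /andP[sT gT] /andP[gt /eqP def_T]; rewrite gt -good_tree_of ?def_T //.
  exact: growth_full gt (size_tuple t).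
(* Growths are grouped by vertex order, which fixes [chain]; the signs in one group add up to
   [weight]. *)
rewrite (partition_big (fun t : k.-tuple _ => map_tuple top t)
   (fun s : k.-tuple V => uniq (rcons s r))) /=; last first.
  by move=> t /andP[gt _]; rewrite -vertsE; apply: grows_uniq gt.
apply: eq_bigr => s Us.
rewrite -(sum_good_lifts K Us) big_distrr -[RHS]big_filter /=.
rewrite (@sum_seq_tuple _ _ k); last 2 first.
- by rewrite filter_uniq ?uniq_lifts.
- move=> t; rewrite mem_filter mem_lifts // => /and3P[_ /eqP st _].
  by rewrite -(size_map top) st size_tuple.
apply: eq_big => [t|t /andP[_ /eqP <-]]; last by rewrite mulrC vertsE.
rewrite mem_filter mem_lifts // -(inj_eq val_inj) /=.
by rewrite andbC [RHS]andbCA andbA andbAC -andbA.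
Qed.

End Assembly.

Theorem mainTheorem7 (G : digraph) (M : rooted_map G) (hconn : connected G) :
  Nnum G = good_tree_sum M /\
  (forall M' : rooted_map G, good_tree_sum M = good_tree_sum M').
Proof.
suff eqN M' : Nnum G = good_tree_sum M' by split=> [|M']; rewrite -!eqN.
(* With a loop both sides vanish: it contributes a zero factor to the full product and, lying in no
   spanning tree, to every term of the sum. *)
case: (pickP [pred e : edge G | origin e == target e]) => [e /= /eqP loop | loopless].
  rewrite /Nnum (bigD1 e) //= loop subrr mul0r mulr0.
  rewrite /good_tree_sum big1 // => T /andP[/andP[_ /acyclicP acyc] _].
  rewrite (bigD1 e) /= ?loop ?subrr ?mul0r //.
  apply/negP=> eT; have /negP[] := acyc [:: (e, false)].
  by rewrite /is_cycle /= eT /dart_vertex /= loop eqxx.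
have {}loopless (e : edge G) : origin e != target e by have /= -> := loopless e.
rewrite /Nnum (Psi_root_expansion M' loopless) -(good_tree_root_expansion M' loopless).
(* In the product over all edges, the tree factors cancel the inverses and the edges outside [T]
   remain. *)
rewrite big_distrl; apply: eq_bigr => T _.
rewrite (bigID (mem T) predT) /= mulrA -big_split /= big1 ?mul1r // => e _.
by rewrite mulVf // subr_eq0 (inj_eq (@xvar_inj G)).
Qed.
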